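(* Let $N\ge1$ and let $\lambda,\mu$ be complex parameters. Consider fields $x,\widetilde{x},\widehat{x},\widehat{\widetilde{x}}\in\mathbb{C}^N$ with indices taken modulo $N$. Suppose that $x,\widetilde{x},\widehat{x}$ satisfy, for all $k$, $$(E)\quad \frac{\sinh(\widetilde{x}_k-x_k+\lambda)}{\sinh(\widetilde{x}_k-x_k-\lambda)}\cdot\frac{\sinh(x_k-\widetilde{x}_{k-1}+\lambda)}{\sinh(x_k-\widetilde{x}_{k-1}-\lambda)}=\frac{\sinh(\widehat{x}_k-x_k+\mu)}{\sinh(\widehat{x}_k-x_k-\mu)}\cdot\frac{\sinh(x_k-\widehat{x}_{k-1}+\mu)}{\sinh(x_k-\widehat{x}_{k-1}-\mu)}.$$ Consider the superposition formulas $$(S1)\quad (e^{4\lambda}-e^{4\mu})\big(e^{2\widehat{x}_k}e^{2\widetilde{x}_k}+e^{2x_{k+1}}e^{2\widehat{\widetilde{x}}_k}\big)+e^{2\mu}(1-e^{4\lambda})\big(e^{2\widehat{x}_k}e^{2\widehat{\widetilde{x}}_k}+e^{2x_{k+1}}e^{2\widetilde{x}_k}\big)+e^{2\lambda}(e^{4\mu}-1)\big(e^{2\widetilde{x}_k}e^{2\widehat{\widetilde{x}}_k}+e^{2x_{k+1}}e^{2\widehat{x}_k}\big)=0,$$ $$(S2)\quad (e^{4\lambda}-e^{4\mu})\big(e^{2\widehat{x}_{k+1}}e^{2\widetilde{x}_{k+1}}+e^{2x_{k+1}}e^{2\widehat{\widetilde{x}}_k}\big)+e^{2\mu}(1-e^{4\lambda})\big(e^{2\widehat{x}_{k+1}}e^{2\widehat{\widetilde{x}}_k}+e^{2x_{k+1}}e^{2\widetilde{x}_{k+1}}\big)+e^{2\lambda}(e^{4\mu}-1)\big(e^{2\widetilde{x}_{k+1}}e^{2\widehat{\widetilde{x}}_k}+e^{2x_{k+1}}e^{2\widehat{x}_{k+1}}\big)=0.$$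 Then, by virtue of $(E)$, (S1) and (S2) are equivalent, and if $\widehat{\widetilde{x}}$ is defined by either of them, then for all $k$: $$(E_1)\quad \frac{\sinh(\widetilde{x}_k-x_k+\lambda)}{\sinh(\widetilde{x}_k-x_k-\lambda)}\cdot\frac{\sinh(x_{k+1}-\widetilde{x}_k+\lambda)}{\sinh(x_{k+1}-\widetilde{x}_k-\lambda)}=\frac{\sinh(\widehat{\widetilde{x}}_k-\widetilde{x}_k+\mu)}{\sinh(\widehat{\widetilde{x}}_k-\widetilde{x}_k-\mu)}\cdot\frac{\sinh(\widetilde{x}_k-\widehat{\widetilde{x}}_{k-1}+\mu)}{\sinh(\widetilde{x}_k-\widehat{\widetilde{x}}_{k-1}-\mu)},$$ $$(E_2)\quad \frac{\sinh(\widehat{x}_k-x_k+\mu)}{\sinh(\widehat{x}_k-x_k-\mu)}\cdot\frac{\sinh(x_{k+1}-\widehat{x}_k+\mu)}{\sinh(x_{k+1}-\widehat{x}_k-\mu)}=\frac{\sinh(\widehat{\widetilde{x}}_k-\widehat{x}_k+\lambda)}{\sinh(\widehat{\widetilde{x}}_k-\widehat{x}_k-\lambda)}\cdot\frac{\sinh(\widehat{x}_k-\widehat{\widetilde{x}}_{k-1}+\lambda)}{\sinh(\widehat{x}_k-\widehat{\widetilde{x}}_{k-1}-\lambda)},$$ $$(E_{12})\quad \frac{\sinh(\widehat{\widetilde{x}}_k-\widehat{x}_k+\lambda)}{\sinh(\widehat{\widetilde{x}}_k-\widehat{x}_k-\lambda)}\cdot\frac{\sinh(\widehat{x}_{k+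1}-\widehat{\widetilde{x}}_k+\lambda)}{\sinh(\widehat{x}_{k+1}-\widehat{\widetilde{x}}_k-\lambda)}=\frac{\sinh(\widehat{\widetilde{x}}_k-\widetilde{x}_k+\mu)}{\sinh(\widehat{\widetilde{x}}_k-\widetilde{x}_k-\mu)}\cdot\frac{\sinh(\widetilde{x}_{k+1}-\widehat{\widetilde{x}}_k+\mu)}{\sinh(\widetilde{x}_{k+1}-\widehat{\widetilde{x}}_k-\mu)}.$$
   Context: These are the corner equations for two Bäcklund transformations $F_\lambda,F_\mu$ of the periodic symmetric hyperbolic multiplicative Toda-type system $\ddot x_k=-(\dot x_k^2-1)\big(\coth(x_{k+1}-x_k)-\coth(x_k-x_{k-1})\big)$, where $F_\lambda:(x,p)\mapsto(\widetilde x,\widetilde p)$ is $e^{2p_k}=\frac{\sinh(\widetilde x_k-x_k+\lambda)}{\sinh(\widetilde x_k-x_k-\lambda)}\cdot\frac{\sinh(x_k-\widetilde x_{k-1}+\lambda)}{\sinh(x_k-\widetilde x_{k-1}-\lambda)}$, $e^{2\widetilde p_k}=\frac{\sinh(\widetilde x_k-x_k+\lambda)}{\sinh(\widetilde x_k-x_k-\lambda)}\cdot\frac{\sinh(x_{k+1}-\widetilde x_k+\lambda)}{\sinh(x_{k+1}-\widetilde x_k-\lambda)}$; hats denote the action of $F_\mu$. *)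

(* Defs.v *)
From Stdlib Require Import Reals ZArith.
From Coquelicot Require Import Coquelicot.
Open Scope C_scope.

Definition Cexp (z : C) : C :=
  ((exp (Re z) * cos (Im z))%R, (exp (Re z) * sin (Im z))%R).
Definition Csinh (z : C) : C := (Cexp z - Cexp (- z)) / 2.

Definition sratio (u nu : C) : C := Csinh (u + nu) / Csinh (u - nu).

(* Fields in C^N with indices modulo N are represented as N-periodic maps Z -> C. *)
Definition periodic (N : nat) (f : Z -> C) : Prop :=
  forall k : Z, f (k + Z.of_nat N)%Z = f k.

Definition eqE (lam mu : C) (x xt xh : Z -> C) (k : Z) : Prop :=
  sratio (xt k - x k) lam * sratio (x k - xt (k - 1)%Z) lam =
  sratio (xh k - x k) mu * sratio (x k - xh (k - 1)%Z) mu.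

Definition S1 (lam mu : C) (x xt xh xht : Z -> C) (k : Z) : Prop :=
  (Cexp (4 * lam) - Cexp (4 * mu)) *
    (Cexp (2 * xh k) * Cexp (2 * xt k) + Cexp (2 * x (k + 1)%Z) * Cexp (2 * xht k))
  + Cexp (2 * mu) * (1 - Cexp (4 * lam)) *
    (Cexp (2 * xh k) * Cexp (2 * xht k) + Cexp (2 * x (k + 1)%Z) * Cexp (2 * xt k))
  + Cexp (2 * lam) * (Cexp (4 * mu) - 1) *
    (Cexp (2 * xt k) * Cexp (2 * xht k) + Cexp (2 * x (k + 1)%Z) * Cexp (2 * xh k))
  = 0.

Definition S2 (lam mu : C) (x xt xh xht : Z -> C) (k : Z) : Prop :=
  (Cexp (4 * lam) - Cexp (4 * mu)) *
    (Cexp (2 * xh (k + 1)%Z) * Cexp (2 * xt (k + 1)%Z) + Cexp (2 * x (k + 1)%Z) * Cexp (2 * xht k))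
  + Cexp (2 * mu) * (1 - Cexp (4 * lam)) *
    (Cexp (2 * xh (k + 1)%Z) * Cexp (2 * xht k) + Cexp (2 * x (k + 1)%Z) * Cexp (2 * xt (k + 1)%Z))
  + Cexp (2 * lam) * (Cexp (4 * mu) - 1) *
    (Cexp (2 * xt (k + 1)%Z) * Cexp (2 * xht k) + Cexp (2 * x (k + 1)%Z) * Cexp (2 * xh (k + 1)%Z))
  = 0.

(* Coefficient of exp(2 xht_k) in (S1), resp. (S2): (S1)/(S2) are affine in
   exp(2 xht_k), and "xht_k is defined by (S1)/(S2)" means this coefficient
   does not vanish. *)
Definition S1coef (lam mu : C) (x xt xh : Z -> C) (k : Z) : C :=
  (Cexp (4 * lam) - Cexp (4 * mu)) * Cexp (2 * x (k + 1)%Z)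
  + Cexp (2 * mu) * (1 - Cexp (4 * lam)) * Cexp (2 * xh k)
  + Cexp (2 * lam) * (Cexp (4 * mu) - 1) * Cexp (2 * xt k).

Definition S2coef (lam mu : C) (x xt xh : Z -> C) (k : Z) : C :=
  (Cexp (4 * lam) - Cexp (4 * mu)) * Cexp (2 * x (k + 1)%Z)
  + Cexp (2 * mu) * (1 - Cexp (4 * lam)) * Cexp (2 * xh (k + 1)%Z)
  + Cexp (2 * lam) * (Cexp (4 * mu) - 1) * Cexp (2 * xt (k + 1)%Z).

Definition eqE1 (lam mu : C) (x xt xht : Z -> C) (k : Z) : Prop :=
  sratio (xt k - x k) lam * sratio (x (k + 1)%Z - xt k) lam =
  sratio (xht k - xt k) mu * sratio (xt k - xht (k - 1)%Z) mu.

Definition eqE2 (lam mu : C) (x xh xht : Z -> C) (k : Z) : Prop :=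
  sratio (xh k - x k) mu * sratio (x (k + 1)%Z - xh k) mu =
  sratio (xht k - xh k) lam * sratio (xh k - xht (k - 1)%Z) lam.

Definition eqE12 (lam mu : C) (xt xh xht : Z -> C) (k : Z) : Prop :=
  sratio (xht k - xh k) lam * sratio (xh (k + 1)%Z - xht k) lam =
  sratio (xht k - xt k) mu * sratio (xt (k + 1)%Z - xht k) mu.

(* Main.v *)
(** In the variables [exp (2 x)] all the equations become rational, and (S1),
    (S2) are one and the same multi-affine quad equation, with the vertices
    [x_(k+1)] and [xht_k] opposite, evaluated on two quads.  This quad equation
    has a three-leg form centred at each vertex: the quotient of two [sratio]
    factors, the short legs, equals a long leg depending only on the centre
    and the opposite vertex.  Each corner equation compares the short legs of
    two quads that share the centre and the opposite vertex; the common long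
    leg cancels unless it is the indeterminate [0 / 0]. *)

Require Import Defs.
From Stdlib Require Import Reals ZArith.
From Coquelicot Require Import Coquelicot.
Open Scope C_scope.

(** * Cancellation in C and the laws of the exponential *)

Lemma Cmult_integral (a b : C) : a * b = 0 -> a = 0 \/ b = 0.
Proof.
  intros H. destruct (Ceq_dec a 0) as [|Ha]; [now left|].
  destruct (Ceq_dec b 0) as [|Hb]; [now right|].
  now destruct (Cmult_neq_0 a b Ha Hb).
Qed.

Lemma Cmult_cancel_l (c a b : C) : c <> 0 -> c * a = c * b -> a = b.
Proof.
  intros Hc H.
  destruct (Cmult_integral c (a - b)) as [|Hab]; [|easy|].
  - replace (c * (a - b)) with (c * a - c * b) by ring. rewrite H. ring.
  - replace a with (a - b + b) by ring. rewrite Hab. ring.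
Qed.

Lemma Csub_eq0 (a b : C) : a - b = 0 -> a = b.
Proof. intros H. replace a with (a - b + b) by ring. rewrite H. ring. Qed.

Lemma Cexp_add (a b : C) : Cexp (a + b) = Cexp a * Cexp b.
Proof.
  unfold Cexp, Cmult, Re, Im; simpl.
  rewrite exp_plus, cos_plus, sin_plus.
  apply injective_projections; simpl; ring.
Qed.

Lemma Cexp_0 : Cexp 0 = 1.
Proof.
  unfold Cexp, Re, Im; simpl. rewrite exp_0, cos_0, sin_0.
  apply injective_projections; simpl; ring.
Qed.

Lemma Cexp_mul_opp (a : C) : Cexp a * Cexp (- a) = 1.
Proof. rewrite <- Cexp_add, <- Cexp_0. f_equal. apply Cplus_opp_r. Qed.

Lemma Cexp_neq_0 (a : C) : Cexp a <> 0.
Proof.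
  intros H. apply C1_nz. rewrite <- (Cexp_mul_opp a), H. ring.
Qed.

Lemma Cexp_opp (a : C) : Cexp (- a) = / Cexp a.
Proof.
  apply (Cmult_cancel_l (Cexp a)); [apply Cexp_neq_0|].
  rewrite Cexp_mul_opp, Cinv_r; auto using Cexp_neq_0.
Qed.

Lemma Cexp_double (a : C) : Cexp (2 * a) = Cexp a * Cexp a.
Proof. rewrite <- Cexp_add. f_equal. apply injective_projections; simpl; ring. Qed.

Lemma Cexp_quadruple (a : C) : Cexp (4 * a) = Cexp (2 * a) * Cexp (2 * a).
Proof. rewrite <- Cexp_add. f_equal. apply injective_projections; simpl; ring. Qed.

Lemma C2_neq_0 : (2 : C) <> 0.
Proof. intros H. injection H. apply not_0_IZR. discriminate. Qed.

(** * Ratios of hyperbolic sines as rational functions of exponentials *)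

Definition leg (l u v : C) : C := (l * u - v) / (u - l * v).

Lemma Csinh_sub_sub (u v nu : C) :
  Csinh (u - v - nu) =
  (Cexp (2 * u) - Cexp (2 * nu) * Cexp (2 * v)) / (2 * (Cexp u * Cexp v * Cexp nu)).
Proof.
  unfold Csinh, Cminus.
  rewrite !Cexp_opp, !Cexp_add, !Cexp_opp, !Cexp_double.
  field. repeat split; auto using Cexp_neq_0, C2_neq_0.
Qed.

Lemma Csinh_sub_add (u v nu : C) :
  Csinh (u - v + nu) =
  (Cexp (2 * nu) * Cexp (2 * u) - Cexp (2 * v)) / (2 * (Cexp u * Cexp v * Cexp nu)).
Proof.
  unfold Csinh, Cminus.
  rewrite !Cexp_opp, !Cexp_add, !Cexp_opp, !Cexp_double.
  field. repeat split; auto using Cexp_neq_0, C2_neq_0.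
Qed.

Lemma Csinh_sub_sub_neq_0 (u v nu : C) :
  Csinh (u - v - nu) <> 0 -> Cexp (2 * u) - Cexp (2 * nu) * Cexp (2 * v) <> 0.
Proof.
  intros H E. apply H. rewrite Csinh_sub_sub, E. unfold Cdiv. ring.
Qed.

Lemma sratio_leg (u v nu : C) :
  Csinh (u - v - nu) <> 0 ->
  sratio (u - v) nu = leg (Cexp (2 * nu)) (Cexp (2 * u)) (Cexp (2 * v)).
Proof.
  intros H%Csinh_sub_sub_neq_0. unfold sratio, leg.
  rewrite Csinh_sub_sub, Csinh_sub_add.
  field. repeat split; auto using Cexp_neq_0, C2_neq_0.
Qed.

(** Clearing denominators makes each corner equation a polynomial identity, which the quad equations
    can reach by [ring]. *)
Lemma leg_mul_eq (l m a b c d e f g h : C) :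
  a - l * b <> 0 -> c - l * d <> 0 -> e - m * f <> 0 -> g - m * h <> 0 ->
  leg l a b * leg l c d = leg m e f * leg m g h <->
  (l * a - b) * (l * c - d) * ((e - m * f) * (g - m * h)) =
  (m * e - f) * (m * g - h) * ((a - l * b) * (c - l * d)).
Proof.
  intros Ha Hc He Hg. unfold leg. split; intros H.
  - apply (Cmult_cancel_l (/ ((a - l * b) * (c - l * d) * (e - m * f) * (g - m * h)))).
    { intros H0. apply C1_nz.
      rewrite <- (Cinv_r ((a - l * b) * (c - l * d) * (e - m * f) * (g - m * h))), H0.
      - ring.
      - repeat apply Cmult_neq_0; assumption. }
    etransitivity; [|etransitivity; [exact H|]]; field; auto.
  - apply (Cmult_cancel_l ((a - l * b) * (c - l * d) * (e - m * f) * (g - m * h))).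
    { repeat apply Cmult_neq_0; assumption. }
    etransitivity; [|etransitivity; [exact H|]]; field; auto.
Qed.

(** * The quad equation and its three-leg forms *)

Definition quad (l m x t h w : C) : C :=
  (l * l - m * m) * (h * t + x * w)
  + m * (1 - l * l) * (h * w + x * t)
  + l * (m * m - 1) * (t * w + x * h).

Definition quad_coef (l m x t h : C) : C :=
  (l * l - m * m) * x + m * (1 - l * l) * h + l * (m * m - 1) * t.

Lemma quad_swap (l m x t h w : C) : quad m l x h t w = - quad l m x t h w.
Proof. unfold quad. ring. Qed.

Lemma quad_coef_swap (l m x t h : C) : quad_coef m l x h t = - quad_coef l m x t h.
Proof. unfold quad_coef. ring. Qed.

(** Cleared form of [leg l x t / leg m w t = (m t - l h) / (l t - m h)]: the two sides differ by [t]
    times the quad polynomial. *)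
Lemma quad_three_leg_t (l m x t h w : C) :
  quad l m x t h w = 0 ->
  (l * x - t) * (w - m * t) * (l * t - m * h) =
  (x - l * t) * (m * w - t) * (m * t - l * h).
Proof.
  intros H. apply Csub_eq0. transitivity (t * quad l m x t h w).
  - unfold quad. ring.
  - rewrite H. ring.
Qed.

Lemma quad_three_leg_w (l m x t h w : C) :
  quad l m x t h w = 0 ->
  (l * w - h) * (w - m * t) * (m * w - l * x) =
  (w - l * h) * (m * w - t) * (l * w - m * x).
Proof.
  intros H. apply Csub_eq0. transitivity (- w * quad l m x t h w).
  - unfold quad. ring.
  - rewrite H. ring.
Qed.

(** * Corner equations by cancelling the long leg *)

Lemma cancel_common_ratio (p r p' r' c d : C) :
  c <> 0 \/ d <> 0 -> p * c = r * d -> p' * c = r' * d -> p * r' = p' * r.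
Proof.
  intros [Hc|Hd] H H'.
  (* Both [p / r] and [p' / r'] stand for [d / c]; either of [c], [d] may vanish alone, so the
     cancelled factor depends on the case. *)
  - apply (Cmult_cancel_l c); trivial.
    replace (c * (p * r')) with (p * c * r') by ring.
    replace (c * (p' * r)) with (p' * c * r) by ring.
    rewrite H, H'. ring.
  - apply (Cmult_cancel_l d); trivial.
    replace (d * (p * r')) with (p * (r' * d)) by ring.
    replace (d * (p' * r)) with (p' * (r * d)) by ring.
    rewrite <- H, <- H'. ring.
Qed.

Lemma Csqr_eq (a b : C) : a * a = b * b -> a = b \/ a = - b.
Proof.
  intros H. destruct (Cmult_integral (a - b) (a + b)) as [E|E].
  - replace ((a - b) * (a + b)) with (a * a - b * b) by ring. rewrite H. ring.
  - left. now apply Csub_eq0.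
  - right. apply Csub_eq0. rewrite <- E. ring.
Qed.

(* [(l u - m v) / (m u - l v)] is the long leg of the three-leg forms. *)
Lemma long_leg_degenerate (l m u v : C) :
  u <> 0 -> (l * u - m * v = 0) -> (m * u - l * v = 0) -> l = m \/ l = - m.
Proof.
  intros Hu H1 H2. apply Csqr_eq, Csub_eq0.
  apply (Cmult_cancel_l u); trivial.
  transitivity (l * (l * u - m * v) - m * (m * u - l * v)); [ring|].
  rewrite H1, H2. ring.
Qed.

Lemma long_leg_dec (l m u v : C) :
  (l * u - m * v <> 0 \/ m * u - l * v <> 0) \/
  (l * u - m * v = 0 /\ m * u - l * v = 0).
Proof.
  destruct (Ceq_dec (l * u - m * v) 0), (Ceq_dec (m * u - l * v) 0); tauto.
Qed.

(** If both vanished, then [l = m] or [l = - m], and the coefficient would be a multiple of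
    [l * t - m * h], hence zero. *)
Lemma long_leg_th_neq_0 (l m x t h : C) :
  l <> 0 -> t <> 0 -> quad_coef l m x t h <> 0 ->
  l * t - m * h <> 0 \/ m * t - l * h <> 0.
Proof.
  intros Hl Ht Hc. destruct (long_leg_dec l m t h) as [|[H1 H2]]; trivial.
  exfalso. apply Hc. unfold quad_coef.
  destruct (long_leg_degenerate l m t h Ht H1 H2) as [E|E]; subst l.
  - transitivity ((m * m - 1) * (m * t - m * h)); [ring|]. rewrite H1. ring.
  - transitivity ((m * m - 1) * (- m * t - m * h)); [ring|]. rewrite H1. ring.
Qed.

(** The two quads share the centre [t] and the opposite vertex [h], hence the long leg. *)
Lemma corner_t (l m x x' t h w w' : C) :
  l <> 0 -> t <> 0 -> quad_coef l m x t h <> 0 ->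
  quad l m x t h w = 0 -> quad l m x' t h w' = 0 ->
  (l * t - x') * (l * x - t) * ((w - m * t) * (t - m * w')) =
  (m * w - t) * (m * t - w') * ((t - l * x') * (x - l * t)).
Proof.
  intros Hl Ht Hc H%quad_three_leg_t H'%quad_three_leg_t.
  pose proof (cancel_common_ratio _ _ _ _ _ _
                (long_leg_th_neq_0 _ _ _ _ _ Hl Ht Hc) H H') as E.
  etransitivity; [|etransitivity; [exact E|]]; ring.
Qed.

(* Unlike in [corner_t], a nonzero [quad_coef] does not exclude a degenerate long
   leg; in that case [w = x] or [w = - x], and the claim is the corner equation
   at [x]. *)
Lemma corner_w (l m x t h t' h' w : C) :
  w <> 0 -> quad_coef l m x t h <> 0 ->
  (l * t' - x) * (l * x - t) * ((h' - m * x) * (x - m * h)) =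
  (m * h' - x) * (m * x - h) * ((t' - l * x) * (x - l * t)) ->
  quad l m x t h w = 0 -> quad l m x t' h' w = 0 ->
  (l * w - h) * (l * h' - w) * ((w - m * t) * (t' - m * w)) =
  (m * w - t) * (m * t' - w) * ((w - l * h) * (h' - l * w)).
Proof.
  intros Hw Hc HE H H'.
  pose proof (quad_three_leg_w _ _ _ _ _ _ H) as L1.
  pose proof (quad_three_leg_w _ _ _ _ _ _ H') as L2.
  destruct (long_leg_dec l m w x) as [Hn|[H1 H2]].
  - pose proof (cancel_common_ratio _ _ _ _ _ _ (proj1 (or_comm _ _) Hn) L1 L2) as E.
    etransitivity; [|etransitivity; [exact E|]]; ring.
  - destruct (long_leg_degenerate l m w x Hw H1 H2) as [E|E]; subst l.
    (* For [l = m] the coefficient times [w - x] is a multiple of [m * w - m * x], which is zero;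
       the case [l = - m] treats [w + x] likewise. *)
    + assert (w = x) as ->.
      { apply (Cmult_cancel_l (quad_coef m m x t h)); trivial.
        apply Csub_eq0.
        transitivity ((1 - m * m) * (h - t) * (m * w - m * x));
          [unfold quad_coef; ring|]. rewrite H1. ring. }
      etransitivity; [|etransitivity; [symmetry; exact HE|]]; ring.
    + assert (w = - x) as ->.
      { apply (Cmult_cancel_l (quad_coef (- m) m x t h)); trivial.
        apply Csub_eq0.
        transitivity ((m * m - 1) * (h + t) * (- m * w - m * x));
          [unfold quad_coef; ring|]. rewrite H1. ring. }
      etransitivity; [|etransitivity; [symmetry; exact HE|]]; ring.
Qed.

(** * The corner equation at [x] makes two quad equations equivalent *)

Lemma quad_coef_proportional (l m x t h t' h' : C) :
  x <> 0 ->
  (l * t' - x) * (l * x - t) * ((h' - m * x) * (x - m * h)) =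
  (m * h' - x) * (m * x - h) * ((t' - l * x) * (x - l * t)) ->
  quad l m x t h 0 * quad_coef l m x t' h' =
  quad l m x t' h' 0 * quad_coef l m x t h.
Proof.
  (* The claim is the vanishing of the resultant in [w] of two affine polynomials; times [x], it is
     [m * m - l * l] times the corner equation. *)
  intros Hx HE. apply (Cmult_cancel_l x); trivial. apply Csub_eq0.
  transitivity ((m * m - l * l) *
    ((l * t' - x) * (l * x - t) * ((h' - m * x) * (x - m * h)) -
     (m * h' - x) * (m * x - h) * ((t' - l * x) * (x - l * t)))).
  - unfold quad, quad_coef. ring.
  - rewrite HE. ring.
Qed.

Lemma quad_transfer (l m x t h t' h' w : C) :
  quad_coef l m x t h <> 0 ->
  quad l m x t h 0 * quad_coef l m x t' h' =
  quad l m x t' h' 0 * quad_coef l m x t h ->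
  quad l m x t h w = 0 -> quad l m x t' h' w = 0.
Proof.
  intros Hc HE H. apply (Cmult_cancel_l (quad_coef l m x t h)); trivial.
  transitivity (quad_coef l m x t' h' * quad l m x t h w +
    (quad l m x t' h' 0 * quad_coef l m x t h -
     quad l m x t h 0 * quad_coef l m x t' h')).
  - unfold quad, quad_coef. ring.
  - rewrite H, HE. ring.
Qed.

(** * Application to the fields *)

Theorem theorem16 (N : nat) (lam mu : C) (x xt xh xht : Z -> C) :
  (1 <= N)%nat ->
  periodic N x -> periodic N xt -> periodic N xh -> periodic N xht ->
  (* all sinh factors in (E) are nonzero (their ratios are the finite,
     nonzero quantities e^{2 p_k}) *)
  (forall k : Z,
     Csinh (xt k - x k + lam) <> 0 /\ Csinh (xt k - x k - lam) <> 0 /\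
     Csinh (x k - xt (k - 1)%Z + lam) <> 0 /\ Csinh (x k - xt (k - 1)%Z - lam) <> 0 /\
     Csinh (xh k - x k + mu) <> 0 /\ Csinh (xh k - x k - mu) <> 0 /\
     Csinh (x k - xh (k - 1)%Z + mu) <> 0 /\ Csinh (x k - xh (k - 1)%Z - mu) <> 0) ->
  (forall k : Z, eqE lam mu x xt xh k) ->
  (* (S1) and (S2) each determine exp(2 xht_k) *)
  (forall k : Z, S1coef lam mu x xt xh k <> 0 /\ S2coef lam mu x xt xh k <> 0) ->
  (forall k : Z, S1 lam mu x xt xh xht k <-> S2 lam mu x xt xh xht k) /\
  ((forall k : Z, S1 lam mu x xt xh xht k) ->
   (* the denominators in (E_1), (E_2), (E_12) do not vanish *)
   (forall k : Z,
      Csinh (x (k + 1)%Z - xt k - lam) <> 0 /\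
      Csinh (xht k - xt k - mu) <> 0 /\ Csinh (xt k - xht (k - 1)%Z - mu) <> 0 /\
      Csinh (x (k + 1)%Z - xh k - mu) <> 0 /\
      Csinh (xht k - xh k - lam) <> 0 /\ Csinh (xh k - xht (k - 1)%Z - lam) <> 0 /\
      Csinh (xh (k + 1)%Z - xht k - lam) <> 0 /\ Csinh (xt (k + 1)%Z - xht k - mu) <> 0) ->
   forall k : Z,
     eqE1 lam mu x xt xht k /\ eqE2 lam mu x xh xht k /\ eqE12 lam mu xt xh xht k).
Proof.
  intros _ _ _ _ _ HEnz HE Hcoef.
  set (l := Cexp (2 * lam)). set (m := Cexp (2 * mu)).
  set (e := fun f : Z -> C => fun k => Cexp (2 * f k)).
  assert (Hl : l <> 0) by apply Cexp_neq_0.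
  assert (Hm : m <> 0) by apply Cexp_neq_0.
  assert (He : forall f k, e f k <> 0) by (intros; apply Cexp_neq_0).
  assert (Hc1 : forall k, quad_coef l m (e x (k + 1)%Z) (e xt k) (e xh k) <> 0).
  { intros k. destruct (Hcoef k) as [H _]. unfold S1coef in H.
    now rewrite !Cexp_quadruple in H. }
  assert (Hc2 : forall k,
    quad_coef l m (e x (k + 1)%Z) (e xt (k + 1)%Z) (e xh (k + 1)%Z) <> 0).
  { intros k. destruct (Hcoef k) as [_ H]. unfold S2coef in H.
    now rewrite !Cexp_quadruple in H. }
  assert (HS1 : forall k, S1 lam mu x xt xh xht k <->
    quad l m (e x (k + 1)%Z) (e xt k) (e xh k) (e xht k) = 0).
  { intros k. unfold S1. now rewrite !Cexp_quadruple. }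
  assert (HS2 : forall k, S2 lam mu x xt xh xht k <->
    quad l m (e x (k + 1)%Z) (e xt (k + 1)%Z) (e xh (k + 1)%Z) (e xht k) = 0).
  { intros k. unfold S2. now rewrite !Cexp_quadruple. }
  (* (E) is taken at [k + 1], since [x (k + 1)] is the vertex common to both quads of index [k]. *)
  assert (HE' : forall k,
    (l * e xt (k + 1)%Z - e x (k + 1)%Z) * (l * e x (k + 1)%Z - e xt k) *
    ((e xh (k + 1)%Z - m * e x (k + 1)%Z) * (e x (k + 1)%Z - m * e xh k)) =
    (m * e xh (k + 1)%Z - e x (k + 1)%Z) * (m * e x (k + 1)%Z - e xh k) *
    ((e xt (k + 1)%Z - l * e x (k + 1)%Z) * (e x (k + 1)%Z - l * e xt k))).
  { intros k. specialize (HE (k + 1)%Z). unfold eqE in HE.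
    destruct (HEnz (k + 1)%Z) as (_ & A & _ & B & _ & D & _ & F).
    replace (k + 1 - 1)%Z with k in * by ring.
    rewrite !sratio_leg in HE by assumption.
    apply leg_mul_eq in HE; auto using Csinh_sub_sub_neq_0. }
  assert (HS : forall k, S1 lam mu x xt xh xht k <-> S2 lam mu x xt xh xht k).
  { intros k. rewrite HS1, HS2.
    pose proof (quad_coef_proportional _ _ _ _ _ _ _ (He x (k + 1)%Z) (HE' k)) as P.
    (* Each direction divides by the coefficient of its own premise. *)
    split; apply quad_transfer; auto. }
  split; [exact HS|].
  intros HS1all Hnz k.
  assert (Q1 : forall k, quad l m (e x (k + 1)%Z) (e xt k) (e xh k) (e xht k) = 0)
    by (intros; now apply HS1).
  assert (Q2 : forall k,
    quad l m (e x (k + 1)%Z) (e xt (k + 1)%Z) (e xh (k + 1)%Z) (e xht k) = 0)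
    by (intros; now apply HS2, HS).
  (* Shifted back by one, (S2) shares the vertices [xt k] and [xh k] with (S1) at [k]; this pair of
     quads yields (E_1) and (E_2). *)
  assert (Q2k : quad l m (e x k) (e xt k) (e xh k) (e xht (k - 1)%Z) = 0).
  { specialize (Q2 (k - 1)%Z). now replace (k - 1 + 1)%Z with k in Q2 by ring. }
  destruct (HEnz k) as (_ & A1 & _ & _ & _ & A2 & _ & _).
  destruct (Hnz k) as (B1 & B2 & B3 & B4 & B5 & B6 & B7 & B8).
  split; [|split].
  - unfold eqE1. rewrite !sratio_leg by assumption.
    apply leg_mul_eq; auto using Csinh_sub_sub_neq_0.
    apply (corner_t l m (e x (k + 1)%Z) (e x k) (e xt k) (e xh k)
             (e xht k) (e xht (k - 1)%Z)); auto.
  - unfold eqE2. rewrite !sratio_leg by assumption.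
    apply leg_mul_eq; auto using Csinh_sub_sub_neq_0.
    (* Exchanging [lam] with [mu] and tilde with hat only changes the sign of the quad polynomial,
       so (E_2) follows as (E_1) did. *)
    apply (corner_t m l (e x (k + 1)%Z) (e x k) (e xh k) (e xt k)
             (e xht k) (e xht (k - 1)%Z)); auto.
    + intros H. apply (Hc1 k). rewrite quad_coef_swap, H. ring.
    + rewrite quad_swap, Q1. ring.
    + rewrite quad_swap, Q2k. ring.
  - unfold eqE12. rewrite !sratio_leg by assumption.
    apply leg_mul_eq; auto using Csinh_sub_sub_neq_0.
    (* Here (S1) and (S2) at the same [k] share the centre [xht k] and the opposite vertex
       [x (k + 1)]. *)
    apply (corner_w l m (e x (k + 1)%Z) (e xt k) (e xh k)
             (e xt (k + 1)%Z) (e xh (k + 1)%Z) (e xht k)); auto.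
Qed.
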